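(* For all integers $\ell\ge0$ and $k\ge\ell+2$, we have $a_{k,k+\ell}=2F_{k+\ell}$.
   Context: $\mathbb{N}=\{1,2,3,\dots\}$, and $\mathcal{N}$ denotes the collection of finite subsets of $\mathbb{N}$. For $E\in\mathcal{N}$ and $k\in\mathbb{N}$, let $\omega_k(E)=\sum_{i\in E,\, i\neq k}1$. For $k,n\in\mathbb{N}$, let $\mathcal{A}_{k,n}=\{E\in\mathcal{N} : E=\emptyset \text{ or } \omega_k(E)<\min E\le \max E\le n\}$ and $a_{k,n}=|\mathcal{A}_{k,n}|$. $(F_n)_{n\ge0}$ is the Fibonacci sequence: $F_0=0$, $F_1=1$, $F_n=F_{n-1}+F_{n-2}$ for $n\ge2$. *)

(* Defs.v *)
From mathcomp Require Import all_boot finmap.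

Set Implicit Arguments.
Unset Strict Implicit.
Unset Printing Implicit Defensive.

Local Open Scope fset_scope.

Fixpoint fib (n : nat) : nat :=
  match n with
  | 0 => 0
  | 1 => 1
  | (m.+1 as p).+1 => fib p + fib m
  end.

(* Here the natural numbers start at 1: finite subsets of {1, 2, 3, ...} are the
   elements of {fset nat} that do not contain 0. *)
Definition positive_fset (E : {fset nat}) : bool := 0 \notin E.

Definition omega (k : nat) (E : {fset nat}) : nat := \sum_(i <- E | i != k) 1.

Definition fset_max (E : {fset nat}) : nat := \max_(i <- E) i.

(* The neutral element fset_max E of the iterated minimum is itself an element
   of E when E is nonempty, so it does not affect the minimum. *)
Definition fset_min (E : {fset nat}) : nat := \big[minn/fset_max E]_(i <- E) i.

Definition admissible (k n : nat) (E : {fset nat}) : bool :=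
  (E == fset0) ||
  [&& omega k E < fset_min E, fset_min E <= fset_max E & fset_max E <= n].

(* The ambient powerset only makes the collection visibly finite; see
   in_calA for the unrestricted membership criterion. *)
Definition calA (k n : nat) : {fset {fset nat}} :=
  [fset E in fpowerset [fset i in iota 1 n] | positive_fset E && admissible k n E].

Definition a_ (k n : nat) : nat := #|` calA k n |.

Lemma fset_max_ge (E : {fset nat}) (i : nat) : i \in E -> i <= fset_max E.
Proof. by move=> iE; rewrite /fset_max (big_rem i) //= leq_maxl. Qed.

Lemma fset_max_in (E : {fset nat}) : E != fset0 -> fset_max E \in E.
Proof.
case/fset0Pn=> x xE; rewrite /fset_max.
have: forall s : seq nat, s != [::] -> \max_(i <- s) i \in s.
  elim=> [//|y s IH] _; rewrite big_cons in_cons.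
  case: (eqVneq s [::]) => [->|/IH ms]; first by rewrite big_nil maxn0 eqxx.
  by case: leqP => _; rewrite ?eqxx ?ms ?orbT.
by apply; apply: contraL xE => /eqP E0; rewrite -[x \in E]/(x \in (E : seq nat)) E0.
Qed.

Lemma fset_min_le (E : {fset nat}) (i : nat) : i \in E -> fset_min E <= i.
Proof.
rewrite /fset_min -[i \in E]/(i \in (E : seq nat)); move: (fset_max E) => m.
elim: (E : seq nat) => // y s IH; rewrite big_cons in_cons.
by case/predU1P=> [->|/IH]; [apply: geq_minl | apply/leq_trans/geq_minr].
Qed.

Lemma fset_min_in (E : {fset nat}) : E != fset0 -> fset_min E \in E.
Proof.
move=> /fset_max_in mE; rewrite /fset_min big_seq.
elim/big_ind: _ => // x y xE yE.
by case: leqP.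
Qed.

Lemma in_calA (k n : nat) (E : {fset nat}) :
  (E \in calA k n) = positive_fset E && admissible k n E.
Proof.
rewrite /calA !inE /= fpowersetE andb_idl // => /andP[E0 adm].
apply/fsubsetP=> i iE; rewrite !inE mem_iota add1n ltnS.
have i0 : 0 < i by rewrite lt0n; apply: contraNneq E0 => <-.
rewrite i0 /=; case/orP: adm => [/eqP E_eq|/and3P[_ _ Hn]].
  by rewrite E_eq inE in iE.
exact: leq_trans (fset_max_ge iE) Hn.
Qed.

(* Main.v *)
(** Let [schreier_count c A] count the [E] contained in [A] all of whose elements
    exceed [c + #|E|]; the empty set always qualifies.  Splitting on whether [E]
    contains an element [x] above all of [A] gives
    [schreier_count c (A + x) = schreier_count c A + schreier_count c.+1 A] as
    soon as [c.+1 < x], which is a Fibonacci recursion; it survives the removal of [k]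
    from [{1, ..., k + l}] when [l < k].  Adding [k] to a set [E] not containing
    it changes neither [omega k E] nor, when [l < k], its admissibility: the new
    condition [omega k E < k] could only fail if all of [E] lay in
    [{k + 1, ..., k + l}], which has fewer than [k] elements.  So
    exactly half of the admissible sets contain [k]. *)
Require Import Defs.
From mathcomp Require Import all_boot finmap zify.

Set Implicit Arguments.
Unset Strict Implicit.
Unset Printing Implicit Defensive.

Local Open Scope fset_scope.
Local Open Scope nat_scope.

Lemma card_fpowersetU1_sep (K : choiceType) (x : K) (A : {fset K})
    (P : pred {fset K}) : x \notin A ->
  #|` [fset E in fpowerset (x |` A) | P E]| =
  #|` [fset E in fpowerset A | P E]| + #|` [fset E in fpowerset A | P (x |` E)]|.
Proof.
move=> xA.
set B := [fset E in _ | P (_ |` E)].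
have <- : #|` [fset x |` E | E in B]| = #|` B|.
  apply/eqP/card_in_imfsetP.
  move=> E F; rewrite !inE /= !fpowersetE => /andP[/fsubsetP EA _] /andP[/fsubsetP FA _].
  move=> eqEF; rewrite -(fsetU1K (a := x) (B := E)) ?(contra (EA x)) //.
  by rewrite eqEF fsetU1K // (contra (FA x)).
(* The two families are disjoint: [x] lies in every set of the second and in none of the first. *)
rewrite -cardfsUI [X in _ + #|` X|](_ : _ = fset0) ?cardfs0 ?addn0; last first.
  apply/fsetP=> E; rewrite !inE /= fpowersetE; apply/negbTE/negP.
  case/andP=> /andP[/fsubsetP EA _] /imfsetP[F _ eqE].
  by move: (EA x); rewrite eqE !inE eqxx (negbTE xA) => /(_ isT).
congr #|` _|; apply/fsetP=> E; rewrite !inE /= !fpowersetE.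
apply/andP/orP=> [[EA PE]|[/andP[EA PE]|/imfsetP[F /=]]].
- have [xE|xE] := boolP (x \in E).
    right; apply/imfsetP; exists (E `\ x) => /=; last by rewrite fsetD1K.
    rewrite !inE /= fpowersetE fsetD1K // PE andbT.
    by rewrite fsubDset.
  left; rewrite PE andbT; apply/fsubsetP=> i iE.
  move/fsubsetP: EA => /(_ i iE); rewrite !inE => /predU1P[ix|//].
  by rewrite -ix iE in xE.
- by split=> //; apply: fsubset_trans EA (fsubsetU1 _ _).
- by rewrite !inE /= fpowersetE => /andP[FA PF] ->; split=> //; apply: fsetUS.
Qed.

(** This is the Schreier condition with strict inequality; the offset [c] records how many larger
    elements have been split off. *)
Definition schreier (c : nat) (E : {fset nat}) : bool :=
  all (fun i => c + #|` E| < i) E.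

Lemma schreierP (c : nat) (E : {fset nat}) :
  reflect (forall i, i \in E -> c + #|` E| < i) (schreier c E).
Proof. exact: allP. Qed.

Definition schreier_count (c : nat) (A : {fset nat}) : nat :=
  #|` [fset E in fpowerset A | schreier c E]|.

Lemma schreierU1 (c x : nat) (E : {fset nat}) : (forall i, i \in E -> i < x) ->
  schreier c (x |` E) = (c.+1 < x) && schreier c.+1 E.
Proof.
move=> Ex; have xE : x \notin E by apply/negP=> /Ex; rewrite ltnn.
apply/schreierP/andP=> [H|[cx /schreierP H] i].
  rewrite cardfsU1 xE in H; split.
    by have := H x; rewrite !inE eqxx => /(_ isT); lia.
  by apply/schreierP=> i iE; have := H i; rewrite !inE iE orbT => /(_ isT); lia.
rewrite cardfsU1 xE !inE => /predU1P[->|/H]; last by lia.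
(* The condition on [x] itself reduces to [c.+1 < x]: any [j] in [E] already gives
   [c.+1 + #|E| < j < x]. *)
have [->|/fset0Pn[j jE]] := eqVneq E fset0; first by rewrite cardfs0; lia.
by have := H j jE; have := Ex j jE; lia.
Qed.

Lemma schreier_countU1 (c x : nat) (A : {fset nat}) : (forall i, i \in A -> i < x) ->
  schreier_count c (x |` A) =
  schreier_count c A + (c.+1 < x) * schreier_count c.+1 A.
Proof.
move=> Ax; have xA : x \notin A by apply/negP=> /Ax; rewrite ltnn.
rewrite /schreier_count card_fpowersetU1_sep //; congr (_ + _).
rewrite (_ : [fset E in fpowerset A | schreier c (x |` E)] =
  [fset E in fpowerset A | (c.+1 < x) && schreier c.+1 E]).
  case: (c.+1 < x); first by rewrite mul1n.
  by rewrite mul0n; apply/eqP; rewrite cardfs_eq0; apply/eqP/fsetP=> E; rewrite !inE andbF.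
apply/fsetP=> E; rewrite !inE /= fpowersetE; apply: andb_id2l => /fsubsetP EA.
by rewrite schreierU1 // => i /EA/Ax.
Qed.

Lemma schreier_count0 (c : nat) : schreier_count c fset0 = 1.
Proof.
rewrite /schreier_count (_ : [fset _ in _ | _] = [fset fset0]) ?cardfs1 //.
apply/fsetP=> E; rewrite !inE /= fpowersetE fsubset0; apply: andb_idr => /eqP->.
by apply/schreierP=> i; rewrite inE.
Qed.

Lemma fibSS (n : nat) : fib n.+2 = fib n.+1 + fib n.
Proof. by []. Qed.

Lemma fset_iotaS (n : nat) :
  [fset i in iota 1 n.+1] = n.+1 |` [fset i in iota 1 n].
Proof. by apply/fsetP=> i; rewrite !inE !mem_iota; lia. Qed.

Lemma schreier_count_iota (c n : nat) :
  schreier_count c [fset i in iota 1 n] = fib (n - c).+1.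
Proof.
elim: n c => [|n IH] c.
  rewrite (_ : [fset i in iota 1 0] = fset0) ?schreier_count0 //.
  by apply/fsetP=> i; rewrite !inE.
rewrite fset_iotaS schreier_countU1 => [|i]; last by rewrite !inE mem_iota; lia.
rewrite !IH ltnS; case: ltnP => cn.
  by rewrite mul1n subSn ?(ltnW cn) // fibSS -(subnSK cn).
(* For [n <= c] only the empty set counts. The new index is 2 if [n = c] and 1 otherwise, and
   [fib 2 = fib 1 = 1]. *)
rewrite mul0n addn0 (eqP cn); have [->|] := eqVneq n c; first by rewrite subSnn.
by move=> nc; rewrite (_ : n.+1 - c = 0) //; lia.
Qed.

(** Induction on the number of elements above [k]: splitting off the largest lowers [l] by one and
    raises [c] by at most one, which preserves [c + l < k]. *)
Lemma schreier_count_iotaD1 (k l c : nat) : c + l < k ->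
  schreier_count c ([fset i in iota 1 (k + l)] `\ k) = fib (k + l - c).
Proof.
elim: l c => [|l IH] c clk.
  rewrite (_ : _ `\ k = [fset i in iota 1 k.-1]).
    by rewrite schreier_count_iota; congr fib; lia.
  by apply/fsetP=> i; rewrite !inE !mem_iota; lia.
rewrite (_ : _ `\ k = (k + l).+1 |` ([fset i in iota 1 (k + l)] `\ k)); last first.
  by apply/fsetP=> i; rewrite !inE !mem_iota; lia.
rewrite schreier_countU1 => [|i]; last by rewrite !inE mem_iota; lia.
rewrite !IH; try lia.
rewrite ltnS (_ : c < k + l) ?mul1n; last lia.
rewrite (_ : k + l.+1 - c = (k + l - c.+1).+2) ?fibSS; last lia.
by rewrite subnSK //; lia.
Qed.

Lemma omegaE (k : nat) (E : {fset nat}) : omega k E + (k \in E) = #|` E|.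
Proof.
rewrite /omega sum1_count -[X in _ + nat_of_bool X]/(k \in (E : seq nat)).
by rewrite -(count_uniq_mem _ (fset_uniq E)) addnC (count_predC (pred1 k)).
Qed.

Lemma admissibleP (k n : nat) (E : {fset nat}) :
  reflect (forall i, i \in E -> omega k E < i <= n) (admissible k n E).
Proof.
apply: (iffP orP) => [[/eqP->|/and3P[oE _ En]] i iE|adm]; first by rewrite inE in iE.
  by rewrite (leq_trans oE (fset_min_le iE)) (leq_trans (fset_max_ge iE) En).
have [->|E0] := eqVneq E fset0; [by left|right].
have /andP[-> _] := adm _ (fset_min_in E0).
by have /andP[_ ->] := adm _ (fset_max_in E0); rewrite fset_min_le // fset_max_in.
Qed.

(** Positivity and the bound [n] amount to containment in [{1, ..., n}], which leaves a predicate on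
    subsets of an interval, ready to be split at [k]. *)
Lemma calAE (k n : nat) : calA k n =
  [fset E in fpowerset [fset i in iota 1 n] |
     all (fun i => omega k E < i) (E : seq nat)].
Proof.
apply/fsetP=> E; rewrite in_calA !inE /= fpowersetE.
apply/andP/andP=> [[E0 /admissibleP adm]|[/fsubsetP En /allP oE]].
  split; last by apply/allP=> i /adm/andP[].
  apply/fsubsetP=> i iE; have /andP[_ le_in] := adm i iE.
  rewrite !inE mem_iota add1n ltnS le_in andbT lt0n.
  by apply: contraNneq E0 => <-.
split; first by apply/negP=> /En; rewrite !inE mem_iota.
apply/admissibleP=> i iE; rewrite oE //=.
by have := En i iE; rewrite !inE mem_iota; lia.
Qed.

Theorem theorem1p4 (l k : nat) (hk : l + 2 <= k) :
  a_ k (k + l) = 2 * fib (k + l).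
Proof.
have lk : l < k by lia.
set B := [fset i in iota 1 (k + l)] `\ k.
have kB : k \notin B by rewrite !inE eqxx.
have omega0 (E : {fset nat}) : E `<=` B -> omega k E = #|` E|.
  move=> /fsubsetP/(_ k) EB; have := omegaE k E.
  by rewrite (negbTE (contra EB kB)) addn0.
have omega1 (E : {fset nat}) : E `<=` B -> omega k (k |` E) = #|` E|.
  move=> /fsubsetP/(_ k) EB; have := omegaE k (k |` E).
  by rewrite cardfsU1 (contra EB kB) fset1U1; lia.
rewrite /a_ calAE (_ : [fset i in iota 1 (k + l)] = k |` B); last first.
  by rewrite fsetD1K // !inE mem_iota; lia.
rewrite card_fpowersetU1_sep // mul2n -addnn.
have <- : schreier_count 0 B = fib (k + l) by rewrite schreier_count_iotaD1 ?subn0.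
rewrite /schreier_count; congr (_ + _); congr #|` _|; apply/fsetP=> E; rewrite !inE /= fpowersetE.
  by apply: andb_id2l => EB; rewrite omega0.
apply: andb_id2l => EB; rewrite omega1 //.
apply/allP/schreierP => [adm i iE|adm i]; first by apply: adm; rewrite !inE iE orbT.
rewrite !inE => /predU1P[->|/adm//].
(* If [k <= #|E|], every element of [E] exceeds [k], whence the contradiction [#|E| <= l < k]. *)
have [//|k_le] := ltnP.
suff /fsubset_leq_card : E `<=` [fset i in iota k.+1 l].
  by rewrite card_fseq undup_id ?iota_uniq // size_iota; lia.
apply/fsubsetP=> j jE; have := adm j jE; have /fsubsetP/(_ j jE) := EB.
by rewrite !inE !mem_iota; lia.
Qed.
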